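(* For any integers $a,b\ge 3$ with $a\le 2b-1$, there exists a graph $G$ such that $\gamma_R(G)=a$ and $\gamma^{p}_{I}(G)=b$.
   Context: All graphs are finite and simple. A perfect Italian dominating function (PID-function) of a graph $G$ is a function $f:V(G)\to\{0,1,2\}$ such that for every vertex $v$ with $f(v)=0$ we have $\sum_{u\in N(v)}f(u)=2$, where $N(v)$ is the open neighborhood of $v$. The weight of a function $f:V(G)\to\{0,1,2\}$ is $\sum_{u\in V(G)}f(u)$. The perfect Italian domination number $\gamma^{p}_{I}(G)$ is the minimum weight of a PID-function of $G$. A Roman dominating function of $G$ is a function $f:V(G)\to\{0,1,2\}$ such that every vertex $v$ with $f(v)=0$ has a neighbor $u$ with $f(u)=2$; the Roman domination number $\gamma_R(G)$ is the minimum weight of a Roman dominating function of $G$. *)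

(* Defs.v *)
From HB Require Import structures.
From mathcomp Require Import all_boot.

Set Implicit Arguments.
Unset Strict Implicit.
Unset Printing Implicit Defensive.

Record sgraph := SGraph {
  vertex :> finType;
  edge : rel vertex;
  edge_sym : symmetric edge;
  edge_irrefl : irreflexive edge
}.

Section Domination.

Variable G : sgraph.
Implicit Types (f : {ffun G -> 'I_3}) (u v : G).

Definition neighborhood v : {set G} := [set u | edge v u].

Definition weight f : nat := \sum_(u : G) f u.

Definition perfect_italian f : bool :=
  [forall v, (f v == 0 :> nat) ==>
     (\sum_(u in neighborhood v) (f u : nat) == 2)].

Definition roman f : bool :=
  [forall v, (f v == 0 :> nat) ==>
     [exists u in neighborhood v, f u == 2 :> nat]].

Definition all_two : {ffun G -> 'I_3} := [ffun=> ord_max].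

Lemma perfect_italian_all_two : perfect_italian all_two.
Proof. by apply/forallP => v; rewrite ffunE. Qed.

Lemma roman_all_two : roman all_two.
Proof. by apply/forallP => v; rewrite ffunE. Qed.

(* [all_two] is only the witness required by [arg min]: it has no vertex of
   value 0, so it satisfies both predicates. *)
Definition perfect_italian_number : nat :=
  weight [arg min_(f < all_two | perfect_italian f) weight f].

Definition roman_number : nat :=
  weight [arg min_(f < all_two | roman f) weight f].

Lemma perfect_italian_numberP :
  (exists2 f, perfect_italian f & weight f = perfect_italian_number) /\
  (forall f, perfect_italian f -> perfect_italian_number <= weight f).
Proof.
rewrite /perfect_italian_number.
by case: arg_minnP => [|f Pf min_f]; [exact: perfect_italian_all_two|split; first by exists f].
Qed.

Lemma roman_numberP :
  (exists2 f, roman f & weight f = roman_number) /\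
  (forall f, roman f -> roman_number <= weight f).
Proof.
rewrite /roman_number.
by case: arg_minnP => [|f Pf min_f]; [exact: roman_all_two|split; first by exists f].
Qed.

End Domination.

(* Main.v *)
Require Import Defs.
From mathcomp Require Import all_boot zify.

Set Implicit Arguments.
Unset Strict Implicit.
Unset Printing Implicit Defensive.

(** Both numbers grow by 1 when an isolated vertex is added, so it suffices to
    realise the pairs (2n - 1, n) for n >= 1 and (3, k + 4) for k >= 0.

    For (2n - 1, n), take n core vertices and, for each pair of them, 2n vertices
    adjacent to exactly that pair. The value 1 on the core is perfect Italian.
    A Roman function of weight below 2n must have value 2 on at least one end of
    each pair, hence on all core vertices but one.

    For (3, k + 4), take two adjacent hubs with k common neighbours, one leaf at
    the second hub and k + 4 leaves at the first. The value 2 on the first hub and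
    1 on the lone leaf is Roman, but a perfect Italian function that is 2 on the
    first hub must be nonzero on every common neighbour. *)

Definition one3 : 'I_3 := @Ordinal 3 1 isT.

(** * Criteria for the two numbers and lower bounds on weights *)

Section DominationFacts.

Variable G : sgraph.
Implicit Types f g : {ffun G -> 'I_3}.

Lemma perfect_italianP f :
  reflect (forall v, f v = 0 :> nat -> \sum_(u | edge v u) f u = 2)
          (perfect_italian f).
Proof.
apply: (iffP forallP) => Pf v.
  move=> fv0; have /implyP/(_ (introT eqP fv0))/eqP := Pf v.
  by apply: etrans; apply: eq_bigl => u; rewrite inE.
apply/implyP => /eqP /Pf sum2; apply/eqP.
by apply: etrans sum2; apply: eq_bigl => u; rewrite inE.
Qed.

Lemma romanP f :
  reflect (forall v, f v = 0 :> nat -> exists2 u, edge v u & f u = 2 :> nat)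
          (roman f).
Proof.
apply: (iffP forallP) => Rf v.
  move=> fv0; have /implyP/(_ (introT eqP fv0))/exists_inP[u] := Rf v.
  by rewrite inE => evu /eqP fu; exists u.
apply/implyP => /eqP /Rf [u evu fu]; apply/exists_inP; exists u; first by rewrite inE.
exact/eqP.
Qed.

Lemma perfect_italian_numberE f k :
  perfect_italian f -> weight f = k ->
  (forall g, perfect_italian g -> k <= weight g) -> perfect_italian_number G = k.
Proof.
move=> Pf wf min_k; have [[g Pg wg] min_g] := perfect_italian_numberP G.
by apply/eqP; rewrite eqn_leq -{1}wf min_g //= -wg min_k.
Qed.

Lemma roman_numberE f k :
  roman f -> weight f = k ->
  (forall g, roman g -> k <= weight g) -> roman_number G = k.
Proof.
move=> Rf wf min_k; have [[g Rg wg] min_g] := roman_numberP G.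
by apply/eqP; rewrite eqn_leq -{1}wf min_g //= -wg min_k.
Qed.

Lemma leq_sum_weight (T : finType) (h : T -> G) f :
  injective h -> \sum_t f (h t) <= weight f.
Proof.
move=> inj_h; have <- := big_imset (A := predT) (fun u => f u : nat) (in2W inj_h).
by rewrite [leqRHS](bigID (mem (h @: predT))) leq_addr.
Qed.

(** Serves to show that a function is too expensive once it is nonzero on a whole family of
    satellites, leaves or core vertices. *)
Lemma leq_card_weight (T : finType) (h : T -> G) f :
  injective h -> (forall t, f (h t) != 0 :> nat) -> #|T| <= weight f.
Proof.
move=> inj_h f_h; apply: leq_trans (leq_sum_weight f inj_h).
by rewrite -sum1_card; apply: leq_sum => t _; rewrite lt0n.
Qed.

End DominationFacts.

Lemma sum_option (T : finType) (P : pred (option T)) (F : option T -> nat) :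
  \sum_(o | P o) F o =
  (if P None then F None else 0) + \sum_(t | P (Some t)) F (Some t).
Proof.
rewrite big_mkcond (bigD1 None) //=; congr (_ + _).
rewrite (reindex_omap Some id) /=; last by case.
by rewrite [RHS]big_mkcond; apply: eq_bigl => t; rewrite eqxx.
Qed.

(** * Adding an isolated vertex *)

Section AddIsolated.

Variable G : sgraph.

Definition isolated_edge (u v : option G) :=
  if (u, v) is (Some x, Some y) then edge x y else false.

Lemma isolated_edge_sym : symmetric isolated_edge.
Proof. by case=> [x|] [y|] //=; exact: edge_sym. Qed.

Lemma isolated_edge_irrefl : irreflexive isolated_edge.
Proof. by case=> [x|] //=; exact: edge_irrefl. Qed.

Definition add_isolated := SGraph isolated_edge_sym isolated_edge_irrefl.

Definition extend_one (f : {ffun G -> 'I_3}) : {ffun add_isolated -> 'I_3} :=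
  [ffun o : option G => if o is Some x then f x else one3].

Definition restrict (f : {ffun add_isolated -> 'I_3}) : {ffun G -> 'I_3} :=
  [ffun x => f (Some x)].

Lemma weight_extend_one f : weight (extend_one f) = (weight f).+1.
Proof.
rewrite /weight sum_option ffunE add1n; congr _.+1.
by apply: eq_bigr => x _; rewrite ffunE.
Qed.

Lemma weight_restrict (f : {ffun add_isolated -> 'I_3}) :
  weight f = f None + weight (restrict f).
Proof.
rewrite /weight sum_option; congr (_ + _).
by apply: eq_bigr => x _; rewrite ffunE.
Qed.

Lemma perfect_italian_extend_one f :
  perfect_italian f -> perfect_italian (extend_one f).
Proof.
move/perfect_italianP => Pf; apply/perfect_italianP => -[x|]; rewrite ffunE //.
move/Pf; apply: etrans; rewrite sum_option /= add0n.
by apply: eq_bigr => y _; rewrite ffunE.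
Qed.

Lemma roman_extend_one f : roman f -> roman (extend_one f).
Proof.
move/romanP => Rf; apply/romanP => -[x|]; rewrite ffunE //.
by case/Rf => y exy fy; exists (Some y); rewrite // ffunE.
Qed.

(** The new vertex [None] has no neighbours, so the value 0 there would force an empty sum to equal
    2. For the same reason it contributes nothing to the sums at old vertices. *)
Lemma perfect_italian_restrict (f : {ffun add_isolated -> 'I_3}) :
  perfect_italian f ->
  perfect_italian (restrict f) /\ f None != 0 :> nat.
Proof.
move/perfect_italianP => Pf; split; last first.
  by apply/eqP => /Pf; rewrite sum_option /= big_pred0.
apply/perfect_italianP => x; rewrite ffunE => /Pf.
by rewrite sum_option /= add0n; apply: etrans; apply: eq_bigr => y _; rewrite ffunE.
Qed.

Lemma roman_restrict (f : {ffun add_isolated -> 'I_3}) :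
  roman f -> roman (restrict f) /\ f None != 0 :> nat.
Proof.
move/romanP => Rf; split; last by apply/eqP => /Rf [].
apply/romanP => x; rewrite ffunE => /Rf [[y|] //= exy fy].
by exists y; rewrite // ffunE.
Qed.

Lemma perfect_italian_number_add_isolated :
  perfect_italian_number add_isolated = (perfect_italian_number G).+1.
Proof.
have [[f Pf wf] min_f] := perfect_italian_numberP G.
apply: (perfect_italian_numberE (perfect_italian_extend_one Pf)).
  by rewrite weight_extend_one wf.
move=> g /perfect_italian_restrict[/min_f le_g g0].
by rewrite weight_restrict -add1n leq_add ?lt0n.
Qed.

Lemma roman_number_add_isolated :
  roman_number add_isolated = (roman_number G).+1.
Proof.
have [[f Rf wf] min_f] := roman_numberP G.
apply: (roman_numberE (roman_extend_one Rf)).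
  by rewrite weight_extend_one wf.
move=> g /roman_restrict[/min_f le_g g0].
by rewrite weight_restrict -add1n leq_add ?lt0n.
Qed.

End AddIsolated.

Lemma numbers_iter_add_isolated m (G : sgraph) :
  roman_number (iter m add_isolated G) = m + roman_number G /\
  perfect_italian_number (iter m add_isolated G) = m + perfect_italian_number G.
Proof.
elim: m => [|m [IHr IHp]] //=.
by rewrite roman_number_add_isolated perfect_italian_number_add_isolated IHr IHp.
Qed.

(** * Graphs with a core and independent satellites attached to it *)

Section CoreSatellite.

Variables (C P : finType) (N : P -> {set C}).
Variables (e : rel C) (e_sym : symmetric e) (e_irrefl : irreflexive e).

Definition core_edge (u v : C + P) :=
  match u, v with
  | inl c, inl d => e c d
  | inl c, inr p | inr p, inl c => c \in N p
  | inr _, inr _ => false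
  end.

Lemma core_edge_sym : symmetric core_edge.
Proof. by case=> [c|p] [d|q] //=. Qed.

Lemma core_edge_irrefl : irreflexive core_edge.
Proof. by case=> [c|p] //=. Qed.

Definition core_satellite := SGraph core_edge_sym core_edge_irrefl.

Implicit Type f : {ffun core_satellite -> 'I_3}.

Lemma weight_core f : weight f = \sum_c f (inl c) + \sum_p f (inr p).
Proof. by rewrite /weight big_sumType. Qed.

Lemma perfect_italian_satellite f p : perfect_italian f ->
  f (inr p) = 0 :> nat -> \sum_(c in N p) f (inl c) = 2.
Proof.
move/perfect_italianP => Pf /Pf.
by rewrite big_sumType /= [X in _ + X]big_pred0 ?addn0.
Qed.

Lemma perfect_italian_core f c : perfect_italian f -> f (inl c) = 0 :> nat ->
  \sum_(d | e c d) f (inl d) + \sum_(p | c \in N p) f (inr p) = 2.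
Proof. by move/perfect_italianP => Pf /Pf; rewrite big_sumType. Qed.

(** Both perfect Italian witnesses below are nonzero on the core, which leaves only conditions at
    satellites. *)
Lemma perfect_italian_core_satellite f :
  (forall c, f (inl c) != 0 :> nat) ->
  (forall p, f (inr p) = 0 :> nat -> \sum_(c in N p) f (inl c) = 2) ->
  perfect_italian f.
Proof.
move=> f_core f_sat; apply/perfect_italianP => -[c|p] fu0.
  by have := f_core c; rewrite fu0.
by rewrite big_sumType /= [X in _ + X]big_pred0 ?addn0 ?f_sat.
Qed.

Lemma roman_satellite f p : roman f ->
  f (inr p) = 0 :> nat -> exists2 c, c \in N p & f (inl c) = 2 :> nat.
Proof. by move/romanP => Rf /Rf [[c|q] //= cNp fc]; exists c. Qed.

End CoreSatellite.

Arguments perfect_italian_satellite {C P N e e_sym e_irrefl f} p.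
Arguments perfect_italian_core {C P N e e_sym e_irrefl f} c.
Arguments roman_satellite {C P N e e_sym e_irrefl f} p.

Lemma sum_twos_but_one n (F : 'I_n -> nat) i :
  (forall j, j != i -> F j = 2) -> \sum_j F j = F i + n.-1.*2.
Proof.
move=> F2; rewrite (bigD1 i) //= (eq_bigr (fun=> 2)) // -muln2.
by rewrite (eq_bigl (mem (predC1 i))) // sum_nat_const cardC1 card_ord.
Qed.

(** * The pair graph, realising (2n - 1, n) *)

Section PairGraph.

Variable n : nat.

(** The second component makes 2n copies of each pair, so that being nonzero on all copies of one
    pair already exceeds 2n - 1. *)
Definition pair_satellite : finType :=
  ({A : {set 'I_n} | #|A| == 2} * 'I_(n.*2))%type.

Definition no_edge (i j : 'I_n) := false.

Lemma no_edge_sym : symmetric no_edge. Proof. by []. Qed.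
Lemma no_edge_irrefl : irreflexive no_edge. Proof. by []. Qed.

Definition pair_graph :=
  core_satellite (fun p : pair_satellite => val p.1) no_edge_sym no_edge_irrefl.

Implicit Type f : {ffun pair_graph -> 'I_3}.

Lemma weight_pair_satellites f i j : i != j ->
  (forall p : pair_satellite, val p.1 = [set i; j] -> f (inr p) != 0 :> nat) ->
  n.*2 <= weight f.
Proof.
move=> ij f_ij; have card2 : #|[set i; j]| == 2 by rewrite cards2 ij.
rewrite -[n.*2]card_ord.
apply: (@leq_card_weight _ _
  (fun l => inr (Sub [set i; j] card2, l) : pair_graph)).
  by move=> l1 l2 [].
by move=> l; apply: f_ij.
Qed.

(** Only the satellites adjacent to [i] are kept: the core has no edges, so they are all the
    neighbours of [i] and must dominate it when its value is 0. *)
Lemma leq_weight_pair_core f (i : 'I_n) :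
  (forall j, j != i -> f (inl j) = 2 :> nat) ->
  n.-1.*2 + f (inl i) +
    \sum_(p : pair_satellite | i \in val p.1) f (inr p) <= weight f.
Proof.
move=> f2; rewrite weight_core (sum_twos_but_one f2).
rewrite [X in _ <= _ + X](bigID (fun p : pair_satellite => i \in val p.1)) /=.
by lia.
Qed.

Lemma roman_number_pair_graph : 0 < n -> roman_number pair_graph = n.*2.-1.
Proof.
move=> n_gt0; pose i0 := Ordinal n_gt0.
(* A pair has at most one end equal to [i0], so every satellite sees a 2. *)
pose f : {ffun pair_graph -> 'I_3} := [ffun u : 'I_n + pair_satellite =>
  if u is inl i then if i == i0 then one3 else ord_max else ord0].
apply: (@roman_numberE _ f).
- apply/romanP => -[i|[[A /= A2] l]]; rewrite ffunE; first by case: eqP.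
  move=> _; have /cards2P[i [j [ij defA]]] := A2.
  have [i_0|i_neq0] := eqVneq i i0.
    exists (inl j); first by rewrite /= defA set22.
    by rewrite ffunE -i_0 eq_sym (negPf ij).
  exists (inl i); first by rewrite /= defA set21.
  by rewrite ffunE (negPf i_neq0).
- rewrite weight_core [X in _ + X]big1 ?addn0; last by move=> p _; rewrite ffunE.
  rewrite (sum_twos_but_one (i := i0)) ?ffunE ?eqxx /=; first by lia.
  by move=> i ii0; rewrite ffunE (negPf ii0).
move=> g Rg.
(* If neither end has value 2, no satellite of the pair can be 0. Hence in a cheap function at most
   one core vertex differs from 2. *)
have pair2 i j : i != j -> g (inl i) != 2 :> nat -> g (inl j) != 2 :> nat ->
    n.*2 <= weight g.
  move=> ij gi gj; apply: (@weight_pair_satellites _ i j ij) => p defp.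
  apply/eqP => /(roman_satellite p Rg)[c]; rewrite defp => /set2P[] -> /eqP.
    exact/negP.
  exact/negP.
have [/existsP[/= i gi]|/existsPn g2] :=
  boolP [exists i : 'I_n, g (inl i) != 2 :> nat]; last first.
  have g2' j : j != i0 -> g (inl j) = 2 :> nat.
    by move=> _; apply/eqP; rewrite -[_ == _]negbK g2.
  have := leq_weight_pair_core g2'.
  by have /negPn/eqP -> := g2 i0; lia.
have [/existsP[/= j /andP[ji gj]]|/existsPn g2] :=
  boolP [exists j : 'I_n, (j != i) && (g (inl j) != 2 :> nat)].
  by apply: leq_trans (leq_pred _) (pair2 _ _ ji gj gi).
have g2' j : j != i -> g (inl j) = 2 :> nat.
  by move=> ji; have := g2 j; rewrite ji /= negbK => /eqP.
have := leq_weight_pair_core g2'.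
(* A nonzero [g (inl i)] gives 2(n - 1) + 1. Otherwise some satellite of [i] has value 2, giving
   2n. *)
have [gi0|] := eqVneq (g (inl i) : nat) 0; last by lia.
have /romanP/(_ _ gi0) [[j //|p] /= ip gp] := Rg.
by rewrite [X in _ + X <= _](bigD1 p) //= gp; lia.
Qed.

Lemma perfect_italian_number_pair_graph :
  0 < n -> perfect_italian_number pair_graph = n.
Proof.
move=> n_gt0.
pose f : {ffun pair_graph -> 'I_3} := [ffun u : 'I_n + pair_satellite =>
  if u is inl i then one3 else ord0].
apply: (@perfect_italian_numberE _ f).
- apply: perfect_italian_core_satellite => [i|[[A /= A2] l]]; rewrite ffunE //= => _.
  rewrite (eq_bigr (fun=> 1)); last by move=> i _; rewrite ffunE.
  by rewrite sum1_card (eqP A2).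
- rewrite weight_core [X in _ + X]big1 ?addn0; last by move=> p _; rewrite ffunE.
  rewrite (eq_bigr (fun=> 1)); last by move=> i _; rewrite ffunE.
  by rewrite sum1_card card_ord.
move=> g Pg.
have [/existsP[/= i /eqP gi]|/existsPn g0] :=
  boolP [exists i : 'I_n, g (inl i) == 0 :> nat]; last first.
  rewrite -{1}[n]card_ord.
  by apply: (@leq_card_weight _ _ (inl : 'I_n -> pair_graph)) => // i j [].
have [/existsP[/= j /andP[ji gj]]|/existsPn g2] :=
  boolP [exists j : 'I_n, (j != i) && (g (inl j) != 2 :> nat)].
  (* A satellite of value 0 at this pair would see only the value of [j], which is not 2. *)
  have : n.*2 <= weight g; last by lia.
  apply: (@weight_pair_satellites _ j i ji) => p defp.
  apply/eqP => /(perfect_italian_satellite p Pg).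
  rewrite defp big_setU1 ?inE //= big_set1 gi addn0.
  exact/eqP.
have g2' j : j != i -> g (inl j) = 2 :> nat.
  by move=> ji; have := g2 j; rewrite ji /= negbK => /eqP.
have := leq_weight_pair_core g2'.
(* The satellites of [i] sum to 2, so the weight is at least 2(n - 1) + 2, which is at least n. *)
have := perfect_italian_core i Pg gi.
by rewrite big_pred0 // add0n => ->; lia.
Qed.

End PairGraph.

(** * The hub graph, realising (3, k + 4) *)

Section HubGraph.

Variable k : nat.

(* [inl] is a common neighbour, [inr None] the lone leaf of the hub [false] and
   [inr (Some _)] a leaf of the hub [true]. *)
Definition hub_satellite : finType := ('I_k + option 'I_(k + 4))%type.

Definition hubs (p : hub_satellite) : {set bool} :=
  match p with
  | inl _ => setT
  | inr None => [set false]
  | inr (Some _) => [set true]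
  end.

Definition hub_edge (b c : bool) := b != c.

Lemma hub_edge_sym : symmetric hub_edge. Proof. by case=> -[]. Qed.
Lemma hub_edge_irrefl : irreflexive hub_edge. Proof. by case. Qed.

Definition hub_graph := core_satellite hubs hub_edge_sym hub_edge_irrefl.

Implicit Type f : {ffun hub_graph -> 'I_3}.

Lemma weight_hub_graph f :
  weight f = f (inl true) + f (inl false) + f (inr (inr None)) +
    \sum_i f (inr (inl i)) + \sum_l f (inr (inr (Some l))).
Proof.
by rewrite weight_core big_bool /= big_sumType /= sum_option /=; lia.
Qed.

Lemma weight_hub_leaves f :
  (forall l, f (inr (inr (Some l))) != 0 :> nat) -> k + 4 <= weight f.
Proof.
move=> fl; rewrite -[k + 4]card_ord.
by apply: (@leq_card_weight _ _
  (fun l : 'I_(k + 4) => inr (inr (Some l)) : hub_graph)) => // l1 l2 [].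
Qed.

Lemma roman_number_hub_graph : roman_number hub_graph = 3.
Proof.
pose f : {ffun hub_graph -> 'I_3} := [ffun u : bool + hub_satellite =>
  match u with inl true => ord_max | inr (inr None) => one3 | _ => ord0 end].
apply: (@roman_numberE _ f).
- apply/romanP => u; rewrite ffunE => fu; exists (inl true); last by rewrite ffunE.
  by case: u fu => [[]|[i|[l|]]] //= _; rewrite inE.
- rewrite weight_hub_graph !ffunE /=.
  by rewrite !big1 // => i _; rewrite ffunE.
move=> g Rg; have [gc|gc] := eqVneq (g (inl true) : nat) 2; last first.
  (* The leaves of the hub [true] have no other neighbour, so without a 2 there they are all
     nonzero. *)
  suff : k + 4 <= weight g by lia.
  apply: weight_hub_leaves => l; apply/eqP => /(roman_satellite _ Rg)[c].
  by rewrite inE => /eqP -> /eqP; exact/negP.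
have := weight_hub_graph g; rewrite gc.
have [gw|] := eqVneq (g (inr (inr None)) : nat) 0; last by lia.
have [c] := roman_satellite _ Rg gw.
by rewrite inE => /eqP -> ->; lia.
Qed.

Lemma perfect_italian_number_hub_graph :
  perfect_italian_number hub_graph = k + 4.
Proof.
(* With 2 on both hubs each leaf sees exactly 2, but a common neighbour sees 4 and therefore gets
   the value 1. *)
pose f : {ffun hub_graph -> 'I_3} := [ffun u : bool + hub_satellite =>
  match u with inl _ => ord_max | inr (inl _) => one3 | _ => ord0 end].
apply: (@perfect_italian_numberE _ f).
- apply: perfect_italian_core_satellite => [c|[i|[l|]]]; rewrite ffunE //= => _;
    by rewrite big_set1 ffunE.
- rewrite weight_hub_graph !ffunE /= (eq_bigr (fun=> 1)); last first.
    by move=> i _; rewrite ffunE.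
  rewrite sum1_card card_ord big1; first by lia.
  by move=> l _; rewrite ffunE.
move=> g Pg; have [gc|gc] := eqVneq (g (inl true) : nat) 2; last first.
  apply: weight_hub_leaves => l; apply/eqP => /(perfect_italian_satellite _ Pg).
  by rewrite big_set1; exact/eqP.
(* If the lone leaf is 0, the hub [false] must be 2. If the leaf is nonzero, a zero at that hub
   would see more than 2, counting the other hub and the leaf. *)
have [gx gxw] : g (inl false) != 0 :> nat /\
    2 <= g (inl false) + g (inr (inr None)).
  have [gw|gw] := eqVneq (g (inr (inr None)) : nat) 0.
    have := perfect_italian_satellite _ Pg gw.
    by rewrite big_set1 => ->.
  suff gx : g (inl false) != 0 :> nat by split=> //; lia.
  apply/eqP => gx; have := perfect_italian_core false Pg gx.
  rewrite (bigD1 true) //= gc.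
  rewrite [X in _ + X](bigD1 (inr None)) ?inE //= => /eqP; apply/negP.
  by rewrite gtn_eqF // -addnA -{1}[2]addn0 ltn_add2l !addn_gt0 (lt0n (g _)) gw orbT.
(* A common neighbour of value 0 would see 2 plus the nonzero value of the hub [false]. *)
have gy : k <= \sum_i g (inr (inl i)).
  rewrite -{1}[k]card_ord -sum1_card; apply: leq_sum => i _.
  rewrite lt0n; apply/eqP => /(perfect_italian_satellite _ Pg).
  rewrite (eq_bigl predT) /= => [|c]; last by rewrite inE.
  rewrite big_bool /= gc => /eqP; apply/negP.
  by rewrite gtn_eqF // -{1}[2]addn0 ltn_add2l lt0n.
by have := weight_hub_graph g; rewrite gc; lia.
Qed.

End HubGraph.

Theorem theorem5p2 (a b : nat) (ha : 3 <= a) (hb : 3 <= b)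
    (hab : a <= 2 * b - 1) :
  exists G : sgraph, roman_number G = a /\ perfect_italian_number G = b.
Proof.
have [le_ba|lt_ab] := leqP b a.
  (* Each isolated vertex preserves the difference of the two numbers, so n - 1 = a - b. The bound
     on [a] makes the number of added vertices a true difference. *)
  exists (iter (2 * b - 1 - a) add_isolated (pair_graph (a - b + 1))).
  have [-> ->] := numbers_iter_add_isolated (2 * b - 1 - a) (pair_graph (a - b + 1)).
  rewrite roman_number_pair_graph ?perfect_italian_number_pair_graph; lia.
(* Here the difference to match is b - a = k + 1. *)
exists (iter (a - 3) add_isolated (hub_graph (b - a - 1))).
have [-> ->] := numbers_iter_add_isolated (a - 3) (hub_graph (b - a - 1)).
rewrite roman_number_hub_graph perfect_italian_number_hub_graph; lia.
Qed.
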